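(* The map $\Gamma:\mathcal{X}^5\to\mathcal{X}$ defined for all $5$-tuples by $$\Gamma(x,a,y,b,z)=\{\omega\in W:\ \exists\,\xi\in x,\alpha\in a,\eta\in y,\beta\in b,\zeta\in z:\ \omega=\zeta+\alpha=\alpha+\eta+\beta=\xi+\beta\}$$ extends the partially defined product map $\Gamma_0:D(\Gamma)\to\mathcal{X}$ (defined in the context through the operators $L,R,M$), and has the following properties: (1) It is symmetric under the Klein $4$-group: for all $x,a,y,b,z\in\mathcal{X}$, (a) $\Gamma(x,a,y,b,z)=\Gamma(z,b,y,a,x)$, (b) $\Gamma(x,a,y,b,z)=\Gamma(a,x,y,z,b)$. (2) For any pair $(a,b)\in\mathcal{X}^2$, the product $(xyz):=\Gamma(x,a,y,b,z)$ on $\mathcal{X}$ satisfies the properties of a semitorsor, that is, for all $x,u,y,v,z\in\mathcal{X}$, $$\Gamma\bigl(x,a,u,b,\Gamma(y,a,v,b,z)\bigr)=\Gamma\bigl(x,a,\Gamma(v,a,y,b,u),b,z\bigr)=\Gamma\bigl(\Gamma(x,a,u,b,y),a,v,b,z\bigr).$$ Writing $\mathcal{X}_{ab}$ for $\mathcal{X}$ equipped with this semitorsor structure, the semitorsor $\mathcal{X}_{ba}$ is the opposite semitorsor of $\mathcal{X}_{ab}$; in particular, $\mathcal{X}_{aa}$ is a commutative semitorsor, for any $a$.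
   Context: $\mathbb{K}$ is a commutative unital ring, $\mathbb{B}$ an associative unital $\mathbb{K}$-algebra, $W$ a right $\mathbb{B}$-module, and $\mathcal{X}=\mathrm{Gras}_{\mathbb{B}}(W)$ is the set of all $\mathbb{B}$-submodules of $W$. For $x,a\in\mathcal{X}$ write $x\top a$ if $W=x\oplus a$; $C_{ab}=\{x\in\mathcal{X}: x\top a,\ x\top b\}$. If $x\top a$, $P_x^a:W\to W$ is the projector onto $x$ with kernel $a$ (lower index: image, upper index: kernel). For a $\mathbb{B}$-linear $f:W\to W$, $[f]$ is its class modulo multiplication by $\mathbb{K}^\times$; it acts on $\mathcal{X}$ by $[f](y)=f(y)$ (image of the submodule). Define $M_{xabz}=[P_x^a-P_b^z]$ if $a\top x$, $z\top b$; $L_{xayb}=[1-P_a^xP_y^b]$ if $a\top x$, $y\top b$; $R_{aybz}=[1-P_b^zP_y^a]$ if $a\top y$, $z\top b$. Let $D_L$ be the set of $(x,a,y,b,z)\in\mathcal{X}^5$ with $x\top a$ and $y\top b$; $D_R$ those with $y\top a$ and $z\top b$; $D_M$ those with $x\top a$, $z\top b$ and $C_{ab}\neq\emptyset$; $D(\Gamma)=D_L\cup D_R\cup D_M$. The map $\Gamma_0:D(\Gamma)\to\mathcal{X}$ is (well-)defined by $\Gamma_0(x,a,y,b,z)=L_{xayb}(z)$ on $D_L$, $=R_{aybz}(x)$ on $D_R$, $=M_{xabz}(y)$ on $D_M$. A semitorsor is a set $G$ with a ternary map $(x,y,z)\mapsto(xyz)$ satisfying the para-associative law $(xy(zuv))=(x(uzy)v)=((xyz)uv)$.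 The opposite semitorsor has product $(x,y,z)\mapsto(zyx)$; commutative means $(xyz)=(zyx)$. *)

(* Defs.v *)
From HB Require Import structures.
From mathcomp Require Import all_boot all_algebra.
From mathcomp Require Import boolp classical_sets.

Set Implicit Arguments.
Unset Strict Implicit.
Unset Printing Implicit Defensive.

Import GRing.Theory.
Local Open Scope ring_scope.
Local Open Scope classical_set_scope.

(* An associative unital K-algebra, given by its structure map c |-> c.1, a
   unital ring morphism from K to the centre.  The library's algType is not
   used because it forces 1 != 0 in the algebra. *)
Record pzAlgebra (K : comPzRingType) := PzAlgebra {
  alg_ring :> pzRingType;
  alg_map : {rmorphism K -> alg_ring};
  alg_central : forall (c : K) (b : alg_ring), alg_map c * b = b * alg_map c
}.

Section Grassmannian.
Variables (K : comPzRingType) (B : pzAlgebra K).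
(* A right B-module is a left module over the converse ring B^c: the right
   action w.b is b *: w. *)
Variable W : lmodType B^c.

Record Gras := MkGras {
  carrier :> set W;
  carrierP : GRing.submod_closed (mem carrier)
}.

Lemma Gras_eq (x y : Gras) : x = y :> set W -> x = y.
Proof.
case: x y => [x px] [y py] /= exy; case: _ / exy py => py.
by congr MkGras; exact: Prop_irrelevance.
Qed.

Lemma Gras0 (x : Gras) : carrier x 0.
Proof. by have [/set_mem] := carrierP x. Qed.

Lemma GrasZD (x : Gras) (c : B^c) (u v : W) :
  carrier x u -> carrier x v -> carrier x (c *: u + v).
Proof.
move=> /mem_set xu /mem_set xv; apply/set_mem.
by have [_] := carrierP x; apply.
Qed.

Lemma GrasD (x : Gras) (u v : W) :
  carrier x u -> carrier x v -> carrier x (u + v).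
Proof. by move=> xu xv; rewrite -[u]scale1r; exact: GrasZD. Qed.

Lemma GrasZ (x : Gras) (c : B^c) (u : W) : carrier x u -> carrier x (c *: u).
Proof. by move=> xu; rewrite -[_ *: _]addr0; apply: GrasZD => //; exact: Gras0. Qed.

Lemma GrasN (x : Gras) (u : W) : carrier x u -> carrier x (- u).
Proof. by move=> xu; rewrite -scaleN1r; exact: GrasZ. Qed.

Lemma GrasB (x : Gras) (u v : W) :
  carrier x u -> carrier x v -> carrier x (u - v).
Proof. by move=> xu /GrasN; exact: GrasD. Qed.

Lemma mk_submod_closed (s : set W) : s 0 ->
  (forall (c : B^c) u v, s u -> s v -> s (c *: u + v)) ->
  GRing.submod_closed (mem s).
Proof.
move=> s0 sZD; split; first exact/mem_set.
by move=> c u v /set_mem su /set_mem sv; apply/mem_set; exact: sZD.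
Qed.

(* x T a : W is the (internal) direct sum of x and a *)
Definition top (x a : Gras) : Prop :=
  [set u + v | u in (x : set W) & v in (a : set W)] = setT /\ x `&` a = [set 0].

Definition Cset (a b : Gras) : set Gras := [set x | top x a /\ top x b].

Fact lin_image_closed (f : {linear W -> W}) (y : Gras) :
  GRing.submod_closed (mem (f @` y)).
Proof.
apply: mk_submod_closed; first by exists 0; [exact: Gras0|exact: linear0].
move=> c _ _ [u yu <-] [v yv <-]; exists (c *: u + v); first exact: GrasZD.
by rewrite linearP.
Qed.

Definition lin_image (f : {linear W -> W}) (y : Gras) : Gras :=
  MkGras (lin_image_closed f y).

(* An element of F (the identity if F is empty) *)
Definition lin_choice (F : set {linear W -> W}) : {linear W -> W} :=
  if pselect (exists f, F f) is left exF then projT1 (cid exF) else idfun.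

Lemma lin_choiceP (F : set {linear W -> W}) f : F f -> F (lin_choice F).
Proof.
rewrite /lin_choice; case: pselect => [exF _|nF Ff]; last by case: nF; exists f.
exact: projT2 (cid exF).
Qed.

Definition is_projector (x a : Gras) (p : {linear W -> W}) : Prop :=
  [/\ forall w, p (p w) = p w, range p = x & p @^-1` [set 0] = a].

Lemma projector_exists (x a : Gras) : top x a -> exists p, is_projector x a p.
Proof.
case=> xaT xa0.
have dec w : exists u, carrier x u /\ carrier a (w - u).
  have : [set u + v | u in (x : set W) & v in (a : set W)] w by rewrite xaT.
  by case=> u xu [v av <-]; exists u; rewrite addrAC subrr add0r.
have uni w u u' : carrier x u -> carrier a (w - u) ->
    carrier x u' -> carrier a (w - u') -> u = u'.
  move=> xu awu xu' awu'; apply/eqP; rewrite -subr_eq0; apply/eqP.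
  have : (x `&` a) (u - u').
    split; first exact: GrasB.
    have -> : u - u' = (w - u') - (w - u).
      by rewrite opprB [RHS]addrC addrA subrK.
    exact: GrasB.
  by rewrite xa0.
pose f w := projT1 (cid (dec w)).
have fx w : carrier x (f w) by rewrite /f; case: cid => u [].
have fa w : carrier a (w - f w) by rewrite /f; case: cid => u [].
have lin : linear f.
  move=> c u v; apply: (uni (c *: u + v)) => //; first exact: GrasZD.
  by rewrite opprD addrACA -scalerBr; exact: GrasZD.
have fid u : carrier x u -> f u = u.
  by move=> xu; apply: (uni u) => //; rewrite subrr; exact: Gras0.
pose F : {linear W -> W} :=
  HB.pack f (GRing.isLinear.Build B^c W W _ f lin).
exists F; split => /=; first by move=> w; rewrite fid.
- by apply/seteqP; split => [_ [w _ <-] //|u xu]; exists u => //; exact: fid.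
- apply/seteqP; split => [w /= fw0|w aw /=].
    by have := fa w; rewrite fw0 subr0.
  by apply: (uni w) => //; [exact: Gras0|rewrite subr0].
Qed.

Lemma projector_uniq (x a : Gras) (p q : {linear W -> W}) :
  is_projector x a p -> is_projector x a q -> p =1 q.
Proof.
move=> [pp px pa] [qq qx qa] w.
have qp : q (p w) = p w.
  have : range q (p w) by rewrite qx -px; exists w.
  by case=> v _ <-.
have : (q @^-1` [set 0]) (w - p w).
  by rewrite qa -pa /= linearB /= pp subrr.
by rewrite /= linearB /= qp => /eqP; rewrite subr_eq0 => /eqP.
Qed.

(* P_x^a, with image x and kernel a; meaningful when top x a *)
Definition proj (x a : Gras) : {linear W -> W} :=
  lin_choice [set p | is_projector x a p].

Lemma projP (x a : Gras) : top x a -> is_projector x a (proj x a).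
Proof. by move=> /projector_exists[p /lin_choiceP]. Qed.

(* [f], the class of f modulo multiplication by K^*; a scalar c in K acts on W
   through its image alg_map B c in B *)
Definition pclass (f : {linear W -> W}) : set {linear W -> W} :=
  [set g | exists2 c : K, (exists d : K, c * d = 1) &
           forall w, g w = (alg_map B c : B^c) *: f w].

(* Independent of the representative chosen, by pactE *)
Definition pact (F : set {linear W -> W}) (y : Gras) : Gras :=
  lin_image (lin_choice F) y.

Lemma pactE (f : {linear W -> W}) (y : Gras) : pact (pclass f) y = lin_image f y.
Proof.
have : pclass f (lin_choice (pclass f)).
  apply: (@lin_choiceP _ f); exists 1; first by exists 1; rewrite mulr1.
  by move=> w; rewrite rmorph1 (scale1r (_ : W)).
case=> c [d cd] fE; apply: Gras_eq; apply/seteqP; split => w /= [u yu <-].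
  exists ((alg_map B c : B^c) *: u); first exact: GrasZ.
  by rewrite fE linearZ.
exists ((alg_map B d : B^c) *: u); first exact: GrasZ.
rewrite fE linearZ /= scalerA -[RHS]scale1r; congr (_ *: _).
change (alg_map B d * alg_map B c = 1).
by rewrite alg_central -rmorphM cd rmorph1.
Qed.

Definition Mop (x a b z : Gras) : set {linear W -> W} :=
  pclass (proj x a \- proj b z).
Definition Lop (x a y b : Gras) : set {linear W -> W} :=
  pclass (idfun \- (proj a x \o proj y b)).
Definition Rop (a y b z : Gras) : set {linear W -> W} :=
  pclass (idfun \- (proj b z \o proj y a)).

Definition DL (x a y b z : Gras) : Prop := top x a /\ top y b.
Definition DR (x a y b z : Gras) : Prop := top y a /\ top z b.
Definition DM (x a y b z : Gras) : Prop :=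
  [/\ top x a, top z b & Cset a b !=set0].
Definition DGamma (x a y b z : Gras) : Prop :=
  [\/ DL x a y b z, DR x a y b z | DM x a y b z].

(* The graph of the partially defined map Gamma_0, with domain DGamma; that the
   three clauses agree where they overlap follows as soon as one total map
   extends this relation. *)
Inductive Gamma0 (x a y b z : Gras) : Gras -> Prop :=
| Gamma0_L of DL x a y b z : Gamma0 x a y b z (pact (Lop x a y b) z)
| Gamma0_R of DR x a y b z : Gamma0 x a y b z (pact (Rop a y b z) x)
| Gamma0_M of DM x a y b z : Gamma0 x a y b z (pact (Mop x a b z) y).

Lemma Gamma0_dom (x a y b z : Gras) :
  (exists w, Gamma0 x a y b z w) <-> DGamma x a y b z.
Proof.
split=> [[_ []] d|]; [exact: Or31|exact: Or32|exact: Or33|].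
by case=> d; eexists; do [exact: Gamma0_L|exact: Gamma0_R|exact: Gamma0_M].
Qed.

Definition Gamma_set (x a y b z : Gras) : set W :=
  [set w | exists xi al eta be ze,
     [/\ carrier x xi, carrier a al, carrier y eta, carrier b be
       & carrier z ze] /\
     [/\ w = ze + al, w = al + eta + be & w = xi + be]].

Fact Gamma_closed (x a y b z : Gras) :
  GRing.submod_closed (mem (Gamma_set x a y b z)).
Proof.
apply: mk_submod_closed.
  by exists 0, 0, 0, 0, 0; rewrite !addr0; do !split => //; exact: Gras0.
move=> c w w' [xi [al [eta [be [ze [[? ? ? ? ?] [e1 e2 e3]]]]]]].
move=> [xi' [al' [eta' [be' [ze' [[? ? ? ? ?] [e1' e2' e3']]]]]]].
exists (c *: xi + xi'), (c *: al + al'), (c *: eta + eta'), (c *: be + be'),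
  (c *: ze + ze'); split; first by split; exact: GrasZD.
split.
- by rewrite {1}e1 e1' scalerDr addrACA.
- by rewrite {1}e2 e2' !scalerDr addrACA; congr (_ + _); rewrite addrACA.
- by rewrite {1}e3 e3' scalerDr addrACA.
Qed.

Definition Gamma (x a y b z : Gras) : Gras := MkGras (Gamma_closed x a y b z).

(* (xyz) in X_ab *)
Definition Gprod (a b x y z : Gras) : Gras := Gamma x a y b z.

End Grassmannian.

Section Semitorsor.
Variable G : Type.
Implicit Type m : G -> G -> G -> G.

Definition semitorsor m : Prop :=
  forall x u y v z,
    m x u (m y v z) = m x (m v y u) z /\ m x (m v y u) z = m (m x u y) v z.

Definition opp_product m : G -> G -> G -> G := fun x y z => m z y x.

Definition commutative_product m : Prop := forall x y z, m x y z = m z y x.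

End Semitorsor.

(* Main.v *)
Require Import Defs.
From mathcomp Require Import all_boot all_algebra.
From mathcomp Require Import boolp classical_sets.

(** Eliminating xi, eta and zeta, a vector w lies in Gamma x a y b z iff there
    are al in a and be in b with w - be in x, w - al - be in y and w - al in z.
    Unfolding this twice turns each of the three terms of the para-associative
    law into the existence of p, q in a and r, s in b such that w - r, w - p - r,
    w - p - s, w - q - s and w - q lie in x, u, y, v and z respectively. *)

Set Implicit Arguments.
Unset Strict Implicit.
Unset Printing Implicit Defensive.

Import GRing.Theory.
Local Open Scope ring_scope.
Local Open Scope classical_set_scope.

Section GammaTheory.
Variables (K : comPzRingType) (B : pzAlgebra K) (W : lmodType B^c).
Implicit Types (x a y b z u v : Gras W) (w : W).

Lemma GrasP x y : (forall w, carrier x w <-> carrier y w) -> x = y.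
Proof. by move=> xy; apply: Gras_eq; apply/seteqP; split=> w /xy. Qed.

Lemma GammaE x a y b z w : carrier (Gamma x a y b z) w <->
  exists al be, [/\ carrier a al, carrier b be &
    [/\ carrier x (w - be), carrier y (w - al - be) & carrier z (w - al)]].
Proof.
split=> [[xi [al [eta [be [ze [[xxi aal yeta bbe zze] [e1 e2 e3]]]]]]]|].
  exists al, be; split=> //; split; first by rewrite e3 addrK.
    by rewrite e2 addrAC addrK [al + eta]addrC addrK.
  by rewrite e1 addrK.
move=> [al [be [aal bbe [xw yw zw]]]].
exists (w - be), al, (w - al - be), be, (w - al); split=> //; rewrite !subrK.
by split=> //; rewrite -addrA subrK [al + _]addrC subrK.
Qed.

Lemma GammaC x a y b z : Gamma x a y b z = Gamma z b y a x.
Proof.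
by apply: GrasP => w; split=> /GammaE[al [be [? ? [? ? ?]]]];
  apply/GammaE; exists be, al; split=> //; split=> //; rewrite addrAC.
Qed.

(** The new witnesses are [w - be] in [x] and [w - al] in [z]; the condition on [y] only changes
    sign. The exchange is an involution, so this inclusion yields the equality. *)
Lemma Gamma_swap_sub x a y b z w :
  carrier (Gamma x a y b z) w -> carrier (Gamma a x y z b) w.
Proof.
move=> /GammaE[al [be [aal bbe [xw yw zw]]]]; apply/GammaE.
exists (w - be), (w - al); split=> //; split; rewrite ?subKr //.
by rewrite -opprB; exact: GrasN.
Qed.

Lemma Gamma_swap x a y b z : Gamma x a y b z = Gamma a x y z b.
Proof. by apply: GrasP => w; split; exact: Gamma_swap_sub. Qed.

Definition assoc_rel x a u y v b z w : Prop :=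
  exists p q r s : W,
    [/\ carrier a p, carrier a q, carrier b r & carrier b s] /\
    [/\ carrier x (w - r), carrier u (w - p - r), carrier y (w - p - s),
        carrier v (w - q - s) & carrier z (w - q)].

Lemma Gamma_nestr x a u y v b z w :
  carrier (Gamma x a u b (Gamma y a v b z)) w <-> assoc_rel x a u y v b z w.
Proof.
split.
  move=> /GammaE[al [be [aal bbe [xw uw]]]].
  move=> /GammaE[al' [be' [aal' bbe' [yw vw zw]]]].
  (* The inner product is evaluated at [w - al], so its witness in [a] is shifted by [al]. *)
  exists al, (al + al'), be, be'; split; first by split=> //; exact: GrasD.
  by rewrite opprD !addrA.
move=> [p [q [r [s [[ap aq br bs] [xw uw yw vw zw]]]]]].
apply/GammaE; exists p, r; split=> //; split=> //.
apply/GammaE; exists (q - p), s; split=> //; first exact: GrasB.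
by rewrite -[w - p - (q - p)]addrA -opprD [p + _]addrC subrK.
Qed.

(** Exchanging [a] and [b] and reversing [x], [u], [y], [v], [z] turns left nesting into right
    nesting; [assoc_rel] follows by reading [p], [q], [r], [s] backwards. *)
Lemma Gamma_nestl x a u y v b z w :
  carrier (Gamma (Gamma x a u b y) a v b z) w <-> assoc_rel x a u y v b z w.
Proof.
rewrite GammaC [Gamma x a u b y]GammaC; split=> [/Gamma_nestr|] [].
  move=> p [q [r [s [[? ? ? ?] [? ? ? ? ?]]]]].
  by exists s, r, q, p; do !split=> //; rewrite addrAC.
move=> p [q [r [s [[? ? ? ?] [? ? ? ? ?]]]]]; apply/Gamma_nestr.
by exists s, r, q, p; do !split=> //; rewrite addrAC.
Qed.

Lemma Gamma_nestm x a u y v b z w :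
  carrier (Gamma x a (Gamma v a y b u) b z) w <-> assoc_rel x a u y v b z w.
Proof.
split.
  move=> /GammaE[al [be [aal bbe [xw]]]].
  move=> /GammaE[al' [be' [aal' bbe' [vw yw uw]]] zw].
  (* The inner product is evaluated at [w - al - be], so its witnesses in [a] and [b] are both
     shifted. *)
  exists (al + al'), al, be, (be + be'); split; first by split=> //; exact: GrasD.
  rewrite !opprD !addrA; split=> //; first by rewrite (addrAC _ (- al')).
  by rewrite (addrAC _ (- al')).
move=> [p [q [r [s [[ap aq br bs] [xw uw yw vw zw]]]]]].
have cancelD c d e : c - d - (e - d) = c - e :> W.
  by rewrite -addrA -opprD [d + _]addrC subrK.
apply/GammaE; exists q, r; split=> //; split=> //.
apply/GammaE; exists (p - q), (s - r); split; [exact: GrasB|exact: GrasB|].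
by split; rewrite ?(addrAC _ (- r)) ?cancelD // addrAC ?cancelD.
Qed.

Lemma Gamma_para_assoc a b x u y v z :
  Gamma x a u b (Gamma y a v b z) = Gamma x a (Gamma v a y b u) b z /\
  Gamma x a (Gamma v a y b u) b z = Gamma (Gamma x a u b y) a v b z.
Proof.
split; apply: GrasP => w.
  by rewrite Gamma_nestr Gamma_nestm.
by rewrite Gamma_nestm Gamma_nestl.
Qed.

Lemma Gprod_semitorsor a b : semitorsor (Gprod a b).
Proof. by move=> x u y v z; exact: Gamma_para_assoc. Qed.

Lemma topC x a : top x a -> top a x.
Proof.
move=> [xaT xa0]; split; last by rewrite setIC.
rewrite -subTset -xaT => _ [u xu [v av <-]].
by exists v => //; exists u => //; rewrite addrC.
Qed.

Section Projector.
Variables (x a : Gras W).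
Hypothesis xa : top x a.

Lemma proj_im w : carrier x (proj x a w).
Proof. by have [_ <- _] := projP xa; exists w. Qed.

Lemma proj_id w : carrier x w -> proj x a w = w.
Proof. by have [pp <- _] := projP xa; case=> v _ <-; exact: pp. Qed.

Lemma proj_ker w : carrier a w -> proj x a w = 0.
Proof. by have [_ _ <-] := projP xa. Qed.

Lemma proj_coim w : carrier a (w - proj x a w).
Proof.
by have [pp _ <-] := projP xa; rewrite /= linearB /= pp subrr.
Qed.

(** Evaluates a projector from an exhibited decomposition, such as those supplied by the witnesses
    of [GammaE]. *)
Lemma proj_unique (v w : W) : carrier x v -> carrier a (w - v) -> proj x a w = v.
Proof.
move=> xv awv; rewrite -[in LHS](subrK v w) linearD /= proj_ker // add0r.
exact: proj_id.
Qed.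

End Projector.

(** Put [ze = w - al] and [eta = w - al - be]. Then [eta] is the [y]-component of [ze] along [b],
    and [eta + al = w - be] lies in [x], so the [a]-component of [eta] along [x] is [- al]; the
    operator thus sends [ze] to [ze + al = w]. *)
Lemma Gamma_L x a y b z :
  DL x a y b z -> Gamma x a y b z = pact (Lop x a y b) z.
Proof.
move=> [/topC ax yb]; rewrite pactE; apply: GrasP => w; split.
  move=> /GammaE[al [be [aal bbe [xw yw zw]]]]; exists (w - al) => //=.
  rewrite (@proj_unique y b yb (w - al - be)) ?subKr //.
  rewrite (@proj_unique a x ax (- al)) ?opprK ?subrK //; first exact: GrasN.
  by rewrite addrAC subrK.
move=> [ze zze <-] /=; set eta := proj y b ze; apply/GammaE.
exists (- proj a x eta), (ze - eta); split; last split.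
- by apply: GrasN; exact: proj_im.
- exact: proj_coim.
- by rewrite addrAC subKr; exact: proj_coim.
- by rewrite opprK subrK subKr; exact: proj_im.
- by rewrite opprK subrK.
Qed.

Lemma Gamma_R x a y b z :
  DR x a y b z -> Gamma x a y b z = pact (Rop a y b z) x.
Proof. by move=> [ya zb]; rewrite GammaC; exact: Gamma_L. Qed.

(** For [eta = w - al - be], the [x]-component along [a] is [w - be] and the [b]-component along [z]
    is [- be]; their difference is [w]. *)
Lemma Gamma_M x a y b z :
  top x a -> top z b -> Gamma x a y b z = pact (Mop x a b z) y.
Proof.
move=> xa /topC bz; rewrite pactE; apply: GrasP => w; split.
  move=> /GammaE[al [be [aal bbe [xw yw zw]]]]; exists (w - al - be) => //=.
  rewrite (@proj_unique x a xa (w - be)) //; last first.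
    by rewrite (addrAC w) (addrAC (w - be)) subrr add0r; exact: GrasN.
  rewrite (@proj_unique b z bz (- be)) ?opprK ?subrK //; exact: GrasN.
move=> [eta yeta <-] /=; apply/GammaE.
exists (proj x a eta - eta), (- proj b z eta); split; last split.
- by rewrite -opprB; apply: GrasN; exact: proj_coim.
- by apply: GrasN; exact: proj_im.
- by rewrite opprK subrK; exact: proj_im.
- by rewrite opprK addrAC subrK subKr.
- by rewrite addrAC subKr; exact: proj_coim.
Qed.

End GammaTheory.

Theorem theorem2p3 (K : comPzRingType) (B : pzAlgebra K) (W : lmodType B^c) :
  (* Gamma extends Gamma_0 *)
  (forall x a y b z w : Gras W,
      Gamma0 x a y b z w -> Gamma x a y b z = w) /\
  (* Klein 4-group symmetry *)
  (forall x a y b z : Gras W,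
      Gamma x a y b z = Gamma z b y a x /\
      Gamma x a y b z = Gamma a x y z b) /\
  (* semitorsor, opposite semitorsor, commutativity *)
  (forall a b : Gras W,
      (forall x u y v z : Gras W,
          Gamma x a u b (Gamma y a v b z) = Gamma x a (Gamma v a y b u) b z /\
          Gamma x a (Gamma v a y b u) b z = Gamma (Gamma x a u b y) a v b z) /\
      semitorsor (Gprod a b) /\
      (forall x y z : Gras W, Gprod b a x y z = opp_product (Gprod a b) x y z)) /\
  (forall a : Gras W,
      semitorsor (Gprod a a) /\ commutative_product (Gprod a a)).
Proof.
split.
  (* One total map satisfies all three clauses, so they agree on overlaps. *)
  by move=> x a y b z w []; [exact: Gamma_L|exact: Gamma_R|case=> *; exact: Gamma_M].
split; first by move=> x a y b z; split; [exact: GammaC|exact: Gamma_swap].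
split=> [a b|a].
  split; first by move=> x u y v z; exact: Gamma_para_assoc.
  split; first exact: Gprod_semitorsor.
  by move=> x y z; exact: GammaC.
split; first exact: Gprod_semitorsor.
(* For [b = a], exchanging [a] and [b] is invisible. *)
by move=> x y z; exact: GammaC.
Qed.
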